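(* Let $d\in\mathbb{N}$, let $\Omega\subseteq\mathbb{R}^d$ be a compact convex subset with dense interior, and fix any norm on $\mathbb{R}^d$. Let $$\mathcal{U}_1:=\{f\in C^\infty_\partial(\Omega,\mathbb{R}^d) : \operatorname{Lip}(f)<1\}.$$ Then $\operatorname{id}_\Omega+f$ is an element of $\operatorname{Diff}_\partial(\Omega)$ for every $f\in\mathcal{U}_1$. Thus $\mathcal{U}_1\subseteq\kappa(\operatorname{Diff}_\partial(\Omega))$, where $\kappa\colon \operatorname{Diff}_\partial(\Omega)\to C^\infty_\partial(\Omega,\mathbb{R}^d)$, $\kappa(\phi)=\phi-\operatorname{id}_\Omega$, so that it makes sense to consider $\kappa^{-1}(f)=\operatorname{id}_\Omega+f$ for $f\in\mathcal{U}_1$.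
   Context: $\Omega\subseteq\mathbb{R}^d$ has dense interior if the interior $\Omega^\circ$ (taken in $\mathbb{R}^d$) is dense in $\Omega$. A map on $\Omega$ is smooth ($C^\infty$) if it extends to a smooth map on an open subset of $\mathbb{R}^d$ containing $\Omega$. $\operatorname{Diff}(\Omega)$ is the group of all $C^\infty$-diffeomorphisms of $\Omega$, i.e. bijections $\phi\colon\Omega\to\Omega$ such that $\phi$ and $\phi^{-1}$ are smooth. With $\partial\Omega$ the topological boundary of $\Omega$, $$\operatorname{Diff}_\partial(\Omega):=\{\phi\in\operatorname{Diff}(\Omega) : \phi(k)=k \ \text{for all } k\in\partial\Omega\},$$ $$C^\infty_\partial(\Omega,\mathbb{R}^d):=\{f\in C^\infty(\Omega,\mathbb{R}^d) : f(k)=0\ \text{for all } k\in\partial\Omega\}.$$ $\operatorname{Lip}(f)$ denotes the (smallest) Lipschitz constant of $f\colon\Omega\to\mathbb{R}^d$ with respect to the fixed norm on $\mathbb{R}^d$, used on both domain and range. *)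

(* Defs.v *)
From HB Require Import structures.
From mathcomp Require Import all_boot all_order all_algebra.
From mathcomp Require Import all_classical all_reals all_analysis.

Set Implicit Arguments.
Unset Strict Implicit.
Unset Printing Implicit Defensive.

Import Order.TTheory GRing.Theory Num.Theory.
Import numFieldNormedType.Exports.

Local Open Scope classical_set_scope.
Local Open Scope ring_scope.

(* An arbitrary norm on R^d; the canonical norm of 'rV[R]_d (the sup norm) only
   provides the topology and the differential calculus, which do not depend on
   the choice of a norm. Nonnegativity follows from the three axioms. *)
Record is_norm (R : realType) (d : nat) (N : 'rV[R]_d -> R) : Prop := IsNorm {
  is_normD : forall x y, N (x + y) <= N x + N y ;
  is_normZ : forall (a : R) x, N (a *: x) = `|a| * N x ;
  is_norm0_eq0 : forall x, N x = 0 -> x = 0 }.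

(* In finite dimension the derivative x |-> 'd g x is C^k as a map into the
   space of linear maps iff x |-> 'd g x v = 'D_v g x is C^k for each v. *)
Fixpoint Ck_on (R : realType) (m n : nat) (k : nat) (U : set 'rV[R]_m)
    (g : 'rV[R]_m -> 'rV[R]_n) : Prop :=
  match k with
  | 0%N => forall x, U x -> {for x, continuous g}
  | k'.+1 => (forall x, U x -> differentiable g x) /\
             (forall v : 'rV[R]_m, Ck_on k' U ('D_v g))
  end.

Definition smooth_on_open (R : realType) (m n : nat) (U : set 'rV[R]_m)
    (g : 'rV[R]_m -> 'rV[R]_n) : Prop :=
  open U /\ forall k : nat, Ck_on k U g.

(* Maps defined on Omega only are functions on the subtype attached to the set
   Omega. The values of g outside U play no role below. *)
Definition smooth (R : realType) (m n : nat) (Omega : set 'rV[R]_m)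
    (f : Omega -> 'rV[R]_n) : Prop :=
  exists (U : set 'rV[R]_m) (g : 'rV[R]_m -> 'rV[R]_n),
    [/\ Omega `<=` U, smooth_on_open U g & forall x : Omega, g (val x) = f x].

Definition dense_interior (R : realType) (d : nat) (Omega : set 'rV[R]_d) :=
  Omega `<=` closure (interior Omega).

Definition boundary (R : realType) (d : nat) (Omega : set 'rV[R]_d) :=
  closure Omega `\` interior Omega.

Definition Diff (R : realType) (d : nat) (Omega : set 'rV[R]_d) :
    set (Omega -> Omega) :=
  [set phi | smooth (fun x : Omega => val (phi x)) /\
     exists psi : Omega -> Omega,
       [/\ cancel phi psi, cancel psi phi &
           smooth (fun x : Omega => val (psi x))]].

Definition Diff_bd (R : realType) (d : nat) (Omega : set 'rV[R]_d) :
    set (Omega -> Omega) :=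
  [set phi | Diff phi /\ forall x : Omega, boundary Omega (val x) -> phi x = x].

Definition Cinf_bd (R : realType) (d : nat) (Omega : set 'rV[R]_d) :
    set (Omega -> 'rV[R]_d) :=
  [set f | smooth f /\ forall x : Omega, boundary Omega (val x) -> f x = 0].

(* +oo when f is not Lipschitz *)
Definition Lip (R : realType) (d : nat) (N : 'rV[R]_d -> R)
    (Omega : set 'rV[R]_d) (f : Omega -> 'rV[R]_d) : \bar R :=
  ereal_inf [set L%:E | L in [set L : R | 0 <= L /\
    forall x y : Omega, N (f x - f y) <= L * N (val x - val y)]].

Definition U1 (R : realType) (d : nat) (N : 'rV[R]_d -> R)
    (Omega : set 'rV[R]_d) : set (Omega -> 'rV[R]_d) :=
  [set f | Cinf_bd f /\ (Lip N f < 1%:E)%E].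

Definition kappa (R : realType) (d : nat) (Omega : set 'rV[R]_d)
    (phi : Omega -> Omega) : Omega -> 'rV[R]_d :=
  fun x => val (phi x) - val x.

(* Main.v *)
(* Extended by 0 outside Omega, f keeps its Lipschitz constant L < 1, since a
   segment leaving Omega meets the boundary, where f vanishes. So id + f is a
   bijection of R^d that is the identity outside Omega, and hence a bijection
   of Omega. By density of the interior the derivative of f has norm at most L
   on all of Omega; by compactness and convexity a smooth extension g of f is
   then L'-Lipschitz with L' < 1 on an open convex set W containing Omega.
   There id + g is injective and open with invertible derivative, and its
   inverse H satisfies D_v H(y) = v (1 + g'(H y))^-1, which makes H smooth by
   induction on the order of differentiability. *)

Require Import Defs.
From HB Require Import structures.
From mathcomp Require Import all_boot all_order all_algebra.
From mathcomp Require Import all_classical all_reals all_analysis.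
From mathcomp Require Import ring lra.
Set Implicit Arguments.
Unset Strict Implicit.
Unset Printing Implicit Defensive.
Import Order.TTheory GRing.Theory Num.Theory.
Import numFieldNormedType.Exports.
Local Open Scope classical_set_scope.
Local Open Scope ring_scope.

(** * Norms on row vectors *)

Lemma coord_le_norm (R : realType) (d : nat) (x : 'rV[R]_d) j :
  `|x ord0 j| <= `|x|.
Proof.
rewrite [leRHS]/Num.Def.normr/= mx_normrE.
exact: (le_bigmax _ (fun ij => `|x ij.1 ij.2|) (ord0, j)).
Qed.

Section norm_theory.
Context (R : realType) (d : nat) (N : 'rV[R]_d -> R) (hN : is_norm N).
Implicit Types x y v : 'rV[R]_d.

Lemma is_norm0 : N 0 = 0.
Proof. by rewrite -(scale0r 0) (is_normZ hN) normr0 mul0r. Qed.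

Lemma is_normN x : N (- x) = N x.
Proof. by rewrite -scaleN1r (is_normZ hN) normrN1 mul1r. Qed.

Lemma is_norm_distrC x y : N (x - y) = N (y - x).
Proof. by rewrite -is_normN opprB. Qed.

Lemma is_norm_ge0 x : 0 <= N x.
Proof.
have := is_normD hN x (- x); rewrite subrr is_norm0 is_normN; lra.
Qed.

Lemma is_norm_gt0 x : x != 0 -> 0 < N x.
Proof.
rewrite lt_neqAle is_norm_ge0 andbT; apply: contra => /eqP/esym.
by move=> /(is_norm0_eq0 hN) ->.
Qed.

Lemma is_norm_distD z x y : N (x - y) <= N (x - z) + N (z - y).
Proof. by rewrite (le_trans _ (is_normD hN _ _))// addrA subrK. Qed.

Lemma is_norm_sum n (F : 'I_n -> 'rV[R]_d) :
  N (\sum_i F i) <= \sum_i N (F i).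
Proof.
elim/big_ind2 : _ => // [|a b x y ha hy]; first by rewrite is_norm0.
by rewrite (le_trans (is_normD hN _ _))// lerD.
Qed.

(** Expanding [x] in the standard basis gives the sum of the [N (delta_mx ord0 i)] as a constant;
    the summand 1 keeps it positive also for [d = 0]. *)
Lemma is_norm_le_mx_norm : exists2 C, 0 < C & forall x, N x <= C * `|x|.
Proof.
exists (1 + \sum_i N (delta_mx ord0 i)) => [|x].
  by rewrite ltr_pwDl// sumr_ge0// => i _; exact: is_norm_ge0.
rewrite {1}(row_sum_delta x) (le_trans (is_norm_sum _))// mulrDl mul1r.
rewrite ler_wpDl ?normr_ge0// mulr_suml ler_sum// => i _.
by rewrite (is_normZ hN) [leLHS]mulrC ler_wpM2l ?is_norm_ge0// coord_le_norm.
Qed.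

Lemma is_norm_dist_dist x y : `|N x - N y| <= N (x - y).
Proof.
have h := is_norm_distD y x 0; have h' := is_norm_distD x y 0.
move: h h'; rewrite !subr0 (is_norm_distrC y x) ler_norml; lra.
Qed.

Lemma is_norm_cvg {T : Type} (F : set_system T) {FF : Filter F}
    (f : T -> 'rV[R]_d) x : f @ F --> x -> N (f t) @[t --> F] --> N x.
Proof.
have [C C0 hC] := is_norm_le_mx_norm => fx.
apply/cvgrPdist_lt => e e0.
have eC0 : 0 < e / C by rewrite divr_gt0.
move/cvgrPdist_lt : fx => /(_ _ eC0); apply: filterS => t xt.
rewrite (le_lt_trans (is_norm_dist_dist _ _))// (le_lt_trans (hC _))//.
by rewrite mulrC -ltr_pdivlMr.
Qed.

Lemma is_norm_continuous : continuous N.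
Proof. by move=> x; apply: (@is_norm_cvg _ (nbhs x) _ id x); exact: cvg_id. Qed.

(** The continuous function [N] attains a positive minimum on the compact unit sphere of the sup
    norm, and homogeneity carries the bound to all vectors. *)
Lemma mx_norm_le_is_norm : exists2 c, 0 < c & forall x, `|x| <= c * N x.
Proof.
(* In the zero space the sphere is empty, so this case is split off. *)
have [allx0|/existsNP[x0 /eqP x00]] := pselect (forall x, x = 0).
  by exists 1 => // x; rewrite (allx0 x) normr0 is_norm0 mulr0.
pose S : set 'rV[R]_d := [set x | `|x| = 1].
have S0 : S !=set0.
  exists (`|x0|^-1 *: x0); rewrite /S/= normrZ normfV normr_id mulVf//.
  by rewrite normr_eq0.
have cS : compact S.
  apply: bounded_closed_compact.
    by exists 1; split=> // M M1 x /= ->; exact: ltW.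
  rewrite (_ : S = (fun x => `|x|) @^-1` [set 1])//.
  apply: closed_comp; first by move=> x _; exact: norm_continuous.
  exact: closed_eq.
have [m mS hm] :=
  compact_EVT_min S0 cS (continuous_subspaceT is_norm_continuous).
have m1 : `|m| = 1 by move/set_mem : mS.
have Nm0 : 0 < N m.
  by apply: is_norm_gt0; rewrite -normr_eq0 m1 oner_eq0.
exists (N m)^-1; first by rewrite invr_gt0.
move=> x; have [->|xn0] := eqVneq x 0; first by rewrite normr0 is_norm0 mulr0.
have xgt0 : 0 < `|x| by rewrite normr_gt0.
have : N m <= N (`|x|^-1 *: x).
  by apply: hm; rewrite inE /S/= normrZ normfV normr_id mulVf// gt_eqF.
rewrite (is_normZ hN) normfV normr_id.
by rewrite ler_pdivlMl// mulrC => h; rewrite ler_pdivlMl.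
Qed.

Definition Nball x (r : R) : set 'rV[R]_d := [set y | N (y - x) <= r].

Lemma Nball_compact x r : compact (Nball x r).
Proof.
have [c c0 hc] := mx_norm_le_is_norm.
apply: bounded_closed_compact.
  exists (`|x| + c * r); split=> [|M M1 y /= xy]; first exact: num_real.
  rewrite -(subrK x y) (le_trans (ler_normD _ _))// (le_trans _ (ltW M1))//.
  by rewrite addrC lerD2l (le_trans (hc _))// ler_wpM2l// ltW.
rewrite (_ : Nball x r = (fun y => N (y - x)) @^-1` [set y | y <= r])//.
apply: closed_comp; last exact: closed_le.
move=> y _; apply: (@is_norm_cvg _ (nbhs y) _ (fun y => y - x) (y - x)).
by apply: cvgB; [exact: cvg_id|exact: cvg_cst].
Qed.

(* The minimizer p of N (T p - p) is fixed, since N (T (T p) - T p) <=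
   L * N (T p - p); this replaces the iteration of Banach's theorem. *)
Lemma contraction_Nball_fixpoint (T : 'rV[R]_d -> 'rV[R]_d) x0 (r L : R) :
  0 <= L < 1 ->
  (forall x y, Nball x0 r x -> Nball x0 r y ->
    N (T x - T y) <= L * N (x - y)) ->
  N (T x0 - x0) <= (1 - L) * r ->
  exists2 p, Nball x0 r p & T p = p.
Proof.
move=> /andP[L0 L1] TL Tx0.
have r0 : 0 <= r.
  by have := is_norm_ge0 (T x0 - x0); nra.
have x0B : Nball x0 r x0 by rewrite /Nball/= subrr is_norm0.
(* [T] maps the ball into itself because L r + (1 - L) r = r. *)
have TB x : Nball x0 r x -> Nball x0 r (T x).
  move=> xB; rewrite /Nball/= (le_trans (is_norm_distD (T x0) _ _))//.
  have := TL _ _ xB x0B; have := xB; rewrite /Nball/=; nra.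
have cT : {within Nball x0 r, continuous (fun x => N (T x - x))}.
  have [C C0 hC] := is_norm_le_mx_norm; have [c c0 hc] := mx_norm_le_is_norm.
  apply/subspace_continuousP => x xB; apply: is_norm_cvg.
  apply: cvgB; last exact: cvg_within.
  apply/cvgrPdist_lt => e e0.
  (* For the sup norm, [T] has Lipschitz constant c L C on the ball; [L + 1] replaces [L] so that
     the divisor is positive. *)
  have K0 : 0 < c * (L + 1) * C by rewrite !mulr_gt0// ltr_wpDl.
  have eK0 : 0 < e / (c * (L + 1) * C) by rewrite divr_gt0.
  rewrite near_withinE; near=> y => yB.
  rewrite (le_lt_trans (hc _))//.
  rewrite (@le_lt_trans _ _ (c * (L + 1) * C * `|x - y|))//.
    rewrite -!mulrA ler_pM2l// (le_trans (TL _ _ xB yB))//.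
    have := hC (x - y); have := is_norm_ge0 (x - y); nra.
  rewrite mulrC -ltr_pdivlMr//; near: y.
have [p /set_mem pB hp] :=
  compact_EVT_min (ex_intro _ _ x0B) (@Nball_compact x0 r) cT.
exists p => //; apply/eqP; rewrite -subr_eq0; apply/eqP.
apply: (is_norm0_eq0 hN).
have := hp (T p) (mem_set (TB _ pB)); have := TL _ _ (TB _ pB) pB.
have := is_norm_ge0 (T p - p); nra.
Unshelve. all: by end_near. Qed.

Lemma contraction_fixpoint (T : 'rV[R]_d -> 'rV[R]_d) (L : R) : 0 <= L < 1 ->
  (forall x y, N (T x - T y) <= L * N (x - y)) -> exists p, T p = p.
Proof.
move=> /[dup] hL /andP[L0 L1] TL.
(* This radius turns the condition on the displacement of the centre into an equality. *)
have := @contraction_Nball_fixpoint T 0 (N (T 0 - 0) / (1 - L)) L hL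
  (fun x y _ _ => TL x y).
rewrite mulrC divfK ?subr_eq0 ?gt_eqF// => /(_ (lexx _))[p _ Tp].
by exists p.
Qed.

End norm_theory.

(* The maximum over [0, 1] of N (g (a + t w) - g a) - M t is attained at t = 0,
   since this function is strictly decreasing just to the left of any t > 0. *)
Lemma mean_value_norm (R : realType) (m d : nat) (N : 'rV[R]_d -> R)
    (hN : is_norm N) (g : 'rV[R]_m -> 'rV[R]_d) (a w : 'rV[R]_m) (M : R) :
  (forall t : R, 0 <= t <= 1 -> differentiable g (a + t *: w)) ->
  (forall t : R, 0 <= t <= 1 -> N ('D_w g (a + t *: w)) < M) ->
  N (g (a + w) - g a) <= M.
Proof.
move=> dg gM.
pose psi (t : R) := N (g (a + t *: w) - g a) - M * t.
have cpsi : {within `[0, 1], continuous psi}.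
  apply: continuous_in_subspaceT => t /set_mem/=; rewrite in_itv/= => t01.
  apply: cvgB; last by apply: cvgM; [exact: cvg_cst|exact: cvg_id].
  apply: (is_norm_cvg hN (F := nbhs t)).
  apply: cvgB; last exact: cvg_cst.
  apply: (@cvg_comp _ _ _ (fun t : R => a + t *: w) g _ (nbhs (a + t *: w))).
    apply: cvgD; first exact: cvg_cst.
    apply: cvgZ; [exact: cvg_id|exact: cvg_cst].
  exact: differentiable_continuous (dg _ t01).
have [c c01 hc] := EVT_max ler01 cpsi.
have psi0 : psi 0 = 0.
  by rewrite /psi scale0r addr0 subrr (is_norm0 hN) mulr0 subrr.
(* If the maximum is attained at 0, then psi 1 <= psi 0 = 0 is the claim. *)
have [c0|cpos] := leP c 0.
  have {c0 c01} c0 : c = 0.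
    by apply/eqP; rewrite eq_le c0; move: c01; rewrite in_itv/= => /andP[].
  have := hc 1; rewrite c0 psi0 in_itv/= ler01 lexx /psi scale1r mulr1 subr_le0.
  exact.
move: c01; rewrite in_itv/= => c01.
have /diff_derivable-/(_ w) dgc := dg _ c01.
have /(is_norm_cvg hN) Nlim := dgc.
have : \forall h \near 0^',
    N (h^-1 *: (g (h *: w + (a + c *: w)) - g (a + c *: w))) < M.
  move/cvgr_lt : Nlim; apply; exact: gM.
rewrite near_withinE => -[e /= e0 he].
(* A step [s] to the left, short enough for the difference quotient at [h = - s] to have norm below
   [M] and for [c - s] to stay in [0, 1]. It yields psi (c - s) > psi c, against the choice of
   [c]. *)
have [s /andP[s0 se] sc] : exists2 s, 0 < s < e & s <= c.
  exists (Num.min (e / 2) c); last by rewrite ge_min lexx orbT.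
  rewrite lt_min cpos divr_gt0//= (@le_lt_trans _ _ (e / 2))//.
    by rewrite ge_min lexx.
  lra.
have /he : ball_ (fun x => `|x|) 0 e (- s).
  by rewrite /ball_/= sub0r opprK gtr0_norm.
rewrite oppr_eq0 gt_eqF// => /(_ isT).
rewrite (is_normZ hN) normfV normrN gtr0_norm//.
have -> : - s *: w + (a + c *: w) = a + (c - s) *: w.
  by rewrite scalerBl scaleNr addrC addrA.
rewrite ltr_pdivrMl// => Ns.
have := hc (c - s); rewrite in_itv/= subr_ge0 sc/=.
have -> : c - s <= 1 by lra.
move=> /(_ isT); rewrite /psi.
have := is_norm_distD hN (g (a + (c - s) *: w)) (g (a + c *: w)) (g a).
rewrite (is_norm_distrC hN (g (a + c *: w)) (g (a + (c - s) *: w))).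
lra.
Qed.

(** * Calculus of C^k maps *)

Lemma differentiable_norm_le (R : numFieldType) (V W : normedModType R)
    (f : V -> W) (x : V) : differentiable f x ->
  forall e, 0 < e ->
    \forall h \near 0, `|f (h + x) - f x - 'd f x h| <= e * `|h|.
Proof.
move=> /diff_locallyP[_ /eqaddoP fx] e e0; move: (fx e e0).
by apply: filterS => h; rewrite /= -addrA -opprD.
Qed.

(** Allows a derivative to be established from an explicit estimate of the remainder instead of
    little-o notation. *)
Lemma norm_le_is_diff (R : realFieldType) (V W : normedModType R)
    (f : V -> W) (x : V) (df : {linear V -> W}) : continuous df ->
  (forall e, 0 < e ->
    \forall h \near 0, `|f (h + x) - f x - df h| <= e * `|h|) ->
  is_diff x f df.
Proof.
move=> dfc fx.
have fdf : f \o shift x = cst (f x) + df +o_ 0 id.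
  apply/eqaddoP => e e0; move: (fx e e0).
  by apply: filterS => h; rewrite /= -addrA -opprD.
have dfE := diff_unique dfc fdf.
by apply: DiffDef => //; apply/diff_locallyP; rewrite dfE.
Qed.

Lemma near_eq_differentiable (R : realFieldType) (V W : normedModType R)
    (f g : V -> W) (x : V) :
  (\near x, f x = g x) -> differentiable f x -> differentiable g x.
Proof.
move=> fg fx; have fgx := nbhs_singleton fg.
suff : is_diff x g ('d f x) by [].
apply: norm_le_is_diff; first exact: diff_continuous.
move=> e e0; have := differentiable_norm_le fx e0.
have : \forall h \near 0, f (h + x) = g (h + x).
  move: fg; rewrite (near_shift 0 x) => /=.
  by apply: filterS => h /=; rewrite subr0.
by apply: filterS2 => h /= -> ; rewrite fgx.
Qed.

Lemma differentiable_rV (R : realFieldType) (V : normedModType R) (n : nat)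
    (f : V -> 'rV[R]_n) (x : V) :
  (forall i, differentiable (fun y => f y ord0 i) x) -> differentiable f x.
Proof.
move=> df.
have -> : f = \sum_i (fun y => f y ord0 i *: delta_mx ord0 i).
  by apply/funext => y; rewrite fct_sumE [LHS]row_sum_delta.
by apply: differentiable_sum => i; exact: differentiableZl.
Qed.

Lemma derive_coord (R : realFieldType) (V : normedModType R) (n : nat)
    (f : V -> 'rV[R]_n) (x v : V) i : differentiable f x ->
  'D_v (fun y => f y ord0 i) x = 'D_v f x ord0 i.
Proof. by move=> /diff_derivable dfx; rewrite derive_mx// mxE. Qed.

(** The chain rule in coordinates: it presents the derivative of a composition as a sum of products,
    a form that suits induction on the order. *)
Lemma derive_comp_rV (R : realFieldType) (V : normedModType R) (n : nat)
    (W : normedModType R) (h : V -> 'rV[R]_n) (f : 'rV[R]_n -> W) (x v : V) :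
  differentiable h x -> differentiable f (h x) ->
  'D_v (f \o h) x =
  \sum_i 'D_v (fun y => h y ord0 i) x *: 'D_(delta_mx ord0 i) f (h x).
Proof.
move=> dh df; rewrite deriveE; last exact: differentiable_comp.
rewrite diff_comp//= -(deriveE v dh) [in LHS](row_sum_delta ('D_v h x)).
rewrite linear_sum; apply: eq_bigr => i _.
by rewrite linearZ/= (deriveE _ df) derive_coord.
Qed.

Section scalar_Ck.
Context (R : realType) (m : nat).
Implicit Types (U : set 'rV[R]_m) (f g : 'rV[R]_m -> R).

(** Real-valued counterpart of [Ck_on], on which products, inverses and determinants can be formed;
    [Ck_on_coordP] links the two. *)
Fixpoint Ck_scalar (k : nat) U f : Prop :=
  match k with
  | 0%N => forall x, U x -> {for x, continuous f}
  | k'.+1 => (forall x, U x -> differentiable f x) /\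
             (forall v : 'rV[R]_m, Ck_scalar k' U ('D_v f))
  end.

(** Since [U] is open, agreement on [U] is agreement near each of its points, which derivatives
    respect. This lets a derivative be replaced by a formula valid on [U] only. *)
Lemma Ck_scalar_eq k U f g : open U -> (forall x, U x -> f x = g x) ->
  Ck_scalar k U f -> Ck_scalar k U g.
Proof.
move=> oU; elim: k f g => [|k IH] f g fg.
  move=> cf x Ux.
  have gf : {near x, f =1 g}.
    by apply: filterS (open_nbhs_nbhs (conj oU Ux)) => y Uy; rewrite fg.
  rewrite /prop_for /continuous_at -fg//.
  apply: cvg_trans (cf x Ux); exact: (@near_eq_cvg _ _ (nbhs x) _ f g).
move=> [df Df]; split=> [x Ux|v].
  apply: near_eq_differentiable (df x Ux).
  by apply: filterS (open_nbhs_nbhs (conj oU Ux)) => y Uy; rewrite fg.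
apply: IH (Df v) => x Ux; apply: near_eq_derive.
by apply: filterS (open_nbhs_nbhs (conj oU Ux)) => y Uy; rewrite fg.
Qed.

Lemma Ck_scalarW k U f : Ck_scalar k.+1 U f -> Ck_scalar k U f.
Proof.
elim: k f => [|k IH] f [df Df].
  by move=> x Ux; apply: differentiable_continuous; exact: df.
by split=> // v; apply: IH; exact: Df.
Qed.

Lemma Ck_scalar_subset k U U' f : U' `<=` U ->
  Ck_scalar k U f -> Ck_scalar k U' f.
Proof.
move=> UU; elim: k f => [|k IH] f; first by move=> cf x /UU; exact: cf.
by move=> [df Df]; split=> [x /UU|v]; [exact: df|exact: IH (Df v)].
Qed.

Lemma Ck_scalar_cst k U (c : R) : open U -> Ck_scalar k U (fun=> c).
Proof.
move=> oU; elim: k c => [|k IH] c; first by move=> x _; exact: cst_continuous.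
split=> [x _|v]; first exact: differentiable_cst.
by apply: Ck_scalar_eq (IH 0) => // x _; rewrite derive_cst.
Qed.

Lemma Ck_scalarD k U f g : open U -> Ck_scalar k U f -> Ck_scalar k U g ->
  Ck_scalar k U (fun x => f x + g x).
Proof.
move=> oU; elim: k f g => [|k IH] f g.
  by move=> cf cg x Ux; exact: (continuousD (cf x Ux) (cg x Ux)).
move=> [df Df] [dg Dg]; split=> [x Ux|v].
  by apply: differentiableD; [exact: df|exact: dg].
apply: Ck_scalar_eq (IH _ _ (Df v) (Dg v)) => // x Ux.
by rewrite deriveD//; apply: diff_derivable; [exact: df|exact: dg].
Qed.

Lemma Ck_scalarM k U f g : open U -> Ck_scalar k U f -> Ck_scalar k U g ->
  Ck_scalar k U (fun x => f x * g x).
Proof.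
move=> oU; elim: k f g => [|k IH] f g.
  by move=> cf cg x Ux; exact: (continuousM (cf x Ux) (cg x Ux)).
move=> Cf Cg; have [df Df] := Cf; have [dg Dg] := Cg; split=> [x Ux|v].
  by apply: differentiableM; [exact: df|exact: dg].
apply: Ck_scalar_eq (Ck_scalarD oU (IH _ _ (Ck_scalarW Cf) (Dg v))
  (IH _ _ (Ck_scalarW Cg) (Df v))) => // x Ux.
by rewrite deriveM//; apply: diff_derivable; [exact: df|exact: dg].
Qed.

(** The derivative of 1/f is - (1/f)^2 f', where 1/f has order [k] by induction. *)
Lemma Ck_scalarV k U f : open U -> (forall x, U x -> f x != 0) ->
  Ck_scalar k U f -> Ck_scalar k U (fun x => (f x)^-1).
Proof.
move=> oU f0; elim: k => [|k IH].
  by move=> cf x Ux; exact: (continuousV (f0 x Ux) (cf x Ux)).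
move=> Cf; have [df Df] := Cf; split=> [x Ux|v].
  by apply: differentiableV; [exact: df|exact: f0].
have CV := IH (Ck_scalarW Cf).
apply: Ck_scalar_eq (Ck_scalarM oU (Ck_scalar_cst k (-1) oU)
  (Ck_scalarM oU (Ck_scalarM oU CV CV) (Df v))) => // x Ux.
rewrite deriveV ?f0//; last exact/diff_derivable/df.
by rewrite mulN1r -scaleNr expr2 invfM.
Qed.

Lemma Ck_scalar_sum k U (I : Type) (r : seq I) (P : pred I)
    (F : I -> 'rV[R]_m -> R) : open U -> (forall i, Ck_scalar k U (F i)) ->
  Ck_scalar k U (fun x => \sum_(i <- r | P i) F i x).
Proof.
move=> oU CF; elim: r => [|i r IH].
  by under eq_fun do rewrite big_nil; exact: Ck_scalar_cst.
under eq_fun do rewrite big_cons; case: (P i) => //.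
exact: Ck_scalarD.
Qed.

Lemma Ck_scalar_prod k U (I : Type) (r : seq I) (P : pred I)
    (F : I -> 'rV[R]_m -> R) : open U -> (forall i, Ck_scalar k U (F i)) ->
  Ck_scalar k U (fun x => \prod_(i <- r | P i) F i x).
Proof.
move=> oU CF; elim: r => [|i r IH].
  by under eq_fun do rewrite big_nil; exact: Ck_scalar_cst.
under eq_fun do rewrite big_cons; case: (P i) => //.
exact: Ck_scalarM.
Qed.

Lemma Ck_scalar_det k U n (A : 'rV[R]_m -> 'M[R]_n) : open U ->
  (forall i j, Ck_scalar k U (fun x => A x i j)) ->
  Ck_scalar k U (fun x => \det (A x)).
Proof.
move=> oU CA; apply: Ck_scalar_sum => // s; apply: Ck_scalarM => //.
  exact: Ck_scalar_cst.
by apply: Ck_scalar_prod.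
Qed.

(** Cramer's rule: the inverse is the adjugate divided by the determinant, and both are polynomial
    in the entries. *)
Lemma Ck_scalar_invmx k U n (A : 'rV[R]_m -> 'M[R]_n) i j : open U ->
  (forall x, U x -> A x \in unitmx) ->
  (forall i j, Ck_scalar k U (fun x => A x i j)) ->
  Ck_scalar k U (fun x => invmx (A x) i j).
Proof.
move=> oU uA CA.
have Cdet : Ck_scalar k U (fun x => (\det (A x))^-1).
  apply: Ck_scalarV => //; last exact: Ck_scalar_det.
  by move=> x Ux; rewrite -unitfE -unitmxE uA.
have Cadj : Ck_scalar k U (fun x => \adj (A x) i j).
  under eq_fun do rewrite mxE.
  apply: Ck_scalarM => //; first exact: Ck_scalar_cst.
  apply: Ck_scalar_det => // i' j'.
  by under eq_fun do rewrite !mxE; exact: CA.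
apply: Ck_scalar_eq (Ck_scalarM oU Cdet Cadj) => // x Ux.
by rewrite /invmx uA// [RHS]mxE.
Qed.

End scalar_Ck.

(** By the chain rule, ['D_v (f \o h)] is a sum of products of derivatives of coordinates of [h]
    with partial derivatives of [f] composed with [h]; induction applies to the latter. *)
Lemma Ck_scalar_comp (R : realType) (m n k : nat) (U : set 'rV[R]_m)
    (U' : set 'rV[R]_n) (h : 'rV[R]_m -> 'rV[R]_n) (f : 'rV[R]_n -> R) :
  open U -> (forall x, U x -> U' (h x)) ->
  (forall x, U x -> {for x, continuous h}) ->
  (forall i, Ck_scalar k U (fun x => h x ord0 i)) ->
  Ck_scalar k U' f -> Ck_scalar k U (f \o h).
Proof.
move=> oU hU ch; elim: k f => [|k IH] f Ch Cf.
  move=> x Ux; apply: continuous_comp; first exact: ch.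
  exact/Cf/hU.
have dh x : U x -> differentiable h x.
  by move=> Ux; apply: differentiable_rV => i; have [+ _] := Ch i; exact.
have [df Df] := Cf; split=> [x Ux|v].
  by apply: differentiable_comp; [exact: dh|exact/df/hU].
have C : Ck_scalar k U (fun x => \sum_i 'D_v (fun y => h y ord0 i) x *
    ('D_(delta_mx ord0 i) f \o h) x).
  apply: Ck_scalar_sum => // i; apply: Ck_scalarM => //.
    by have [_] := Ch i; exact.
  by apply: IH => [j|]; [exact: Ck_scalarW (Ch j)|exact: Df].
apply: Ck_scalar_eq C => // x Ux.
by rewrite derive_comp_rV//; [exact: dh|exact/df/hU].
Qed.

Lemma Ck_on_coordP (R : realType) (m n k : nat) (U : set 'rV[R]_m)
    (g : 'rV[R]_m -> 'rV[R]_n) : open U ->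
  Ck_on k U g <-> forall i, Ck_scalar k U (fun x => g x ord0 i).
Proof.
move=> oU; elim: k g => [|k IH] g.
  split=> [cg i x Ux|cg x Ux].
    exact: (@continuous_comp _ _ _ g (fun M : 'rV[R]_n => M ord0 i) x
      (cg _ Ux) (@coord_continuous R 1 n ord0 i (g x))).
  apply/(@cvgrPdist_lt _ _ _ (nbhs x)) => e e0.
  near=> y; rewrite [ltLHS]/Num.Def.normr/= mx_normrE.
  apply/bigmax_ltP; split=> //= -[i j] _ /=; rewrite !mxE (ord1 i).
  move: j; near: y; apply: filter_forall => j.
  by have /(@cvgrPdist_lt _ _ _ (nbhs x)) := cg j x Ux; exact.
split=> [[dg Dg] i|Cg].
  split=> [x Ux|v].
    exact: (@differentiable_comp R _ _ _ g (fun M : 'rV[R]_n => M ord0 i) _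
      (dg _ Ux) (@differentiable_coord _ _ _ _ _ _)).
  apply: Ck_scalar_eq ((IH _).1 (Dg v) i) => // x Ux.
  by rewrite derive_coord//; exact: dg.
have dg x : U x -> differentiable g x.
  by move=> Ux; apply: differentiable_rV => i; have [+ _] := Cg i; exact.
split=> // v; apply/IH => i; have [_ /(_ v)] := Cg i.
by apply: Ck_scalar_eq => // x Ux; rewrite derive_coord//; exact: dg.
Unshelve. all: by end_near. Qed.

(** * Extending the Lipschitz bound to a neighborhood *)

Lemma convex_set_line (R : realType) (V : lmodType R)
    (A : set (convex_lmodType V)) (x y : V) (t : R) :
  convex_set A -> A x -> A y -> 0 <= t <= 1 ->
  A (x + t *: (y - x)).
Proof.
move=> cA Ax Ay /andP[t0 t1].
have := cA y x (Itv01 t0 t1) (mem_set Ay) (mem_set Ax) => /set_mem.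
rewrite (_ : x + _ = t *: y + (1 - t) *: x)//.
by rewrite scalerBr scalerBl scale1r addrCA.
Qed.

(** Half the radius of a ball around a point of [A] inside [B] serves all points within that half
    radius; compactness then gives one radius for all of [A]. *)
Lemma compact_open_tube (R : realType) (d : nat) (A B : set 'rV[R]_d) :
  compact A -> (forall x, A x -> nbhs x B) ->
  exists2 e : R, 0 < e & forall x y, A x -> `|x - y| < e -> B y.
Proof.
move=> /compact_near_coveringP cA AB.
have : \forall e \near (0 : R)^'+,
    A `<=` [set x | forall y, `|x - y| < e -> B y].
  apply: (cA _ _ (fun e x => forall y, `|x - y| < e -> B y)) => x Ax.
  have /nbhs_ballP[r /= r0 xrB] := AB x Ax.
  have r20 : 0 < r / 2 by rewrite divr_gt0.
  exists (ball x (r / 2), [set e | e < r / 2]) => /=.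
    split; first exact: nbhsx_ballx.
    exact: nbhs_right_lt.
  move=> [z e] /= [+ er y zy]; rewrite -ball_normE /= => xz.
  apply: xrB; rewrite -ball_normE/= -(subrK z x) -addrA.
  rewrite (le_lt_trans (ler_normD _ _))// (splitr r) ltrD//.
  exact: lt_trans zy er.
move=> [r /= r0 hr]; exists (r / 2); first by rewrite divr_gt0.
move=> x y Ax; apply: (hr (r / 2)) => //=; last by rewrite divr_gt0.
by rewrite sub0r normrN gtr0_norm ?divr_gt0//; lra.
Qed.

Section derive_norm.
Context (R : realType) (d : nat) (N : 'rV[R]_d -> R) (hN : is_norm N).

Lemma Lipschitz_derive_le (g : 'rV[R]_d -> 'rV[R]_d) (x v : 'rV[R]_d) (L : R) :
  differentiable g x -> (\forall y \near x, N (g y - g x) <= L * N (y - x)) ->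
  N ('D_v g x) <= L * N v.
Proof.
move=> /diff_derivable-/(_ v) dg gL.
have /(is_norm_cvg hN) Nlim := dg.
rewrite -(cvg_lim _ Nlim)//; apply: limr_le.
  by apply/cvg_ex; eexists; exact: Nlim.
have : \forall h \near 0, N (g (h *: v + x) - g x) <= L * N (h *: v + x - x).
  have cx : (h *: v + x) @[h --> (0 : R)] --> x.
    suff : (h *: v + x) @[h --> (0 : R)] --> 0 *: v + x.
      by rewrite scale0r add0r.
    apply: cvgD; last exact: cvg_cst.
    by apply: cvgZ; [exact: cvg_id|exact: cvg_cst].
  exact: cx gL.
rewrite near_withinE; apply: filterS => h hL h0.
rewrite (is_normZ hN) normfV ler_pdivrMl ?normr_gt0// (le_trans hL)//.
by rewrite addrK (is_normZ hN) mulrCA.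
Qed.

Lemma derive_sum_delta (g : 'rV[R]_d -> 'rV[R]_d) (x v : 'rV[R]_d) :
  differentiable g x ->
  'D_v g x = \sum_i v ord0 i *: 'D_(delta_mx ord0 i) g x.
Proof.
move=> dg; rewrite deriveE// [in LHS](row_sum_delta v) linear_sum.
by apply: eq_bigr => i _; rewrite linearZ/= -deriveE.
Qed.

Lemma near_derive_norm_le (g : 'rV[R]_d -> 'rV[R]_d) (U : set 'rV[R]_d)
    (x : 'rV[R]_d) (L L1 : R) : open U -> Ck_on 1 U g -> U x -> L < L1 ->
  (forall v, N ('D_v g x) <= L * N v) ->
  \forall y \near x, forall v, N ('D_v g y) <= L1 * N v.
Proof.
move=> oU [dg Dg] Ux LL1 gL.
have [c c0 hc] := mx_norm_le_is_norm hN.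
(* One neighborhood must serve all [v], so the derivatives are compared on the basis vectors: N
   ('D_v g y - 'D_v g x) <= [|v|] E y <= c N v E y, and E is continuous with E x = 0. *)
pose E y := \sum_i N ('D_(delta_mx ord0 i) g y - 'D_(delta_mx ord0 i) g x).
have cE : {for x, continuous E}.
  apply: (@cvg_big _ _ _ _ _ _ _ (nbhs x)) => [|i _].
    exact: add_continuous.
  apply: (is_norm_cvg hN (F := nbhs x)).
  by apply: (@cvgB _ _ _ (nbhs x)); [exact: Dg|exact: cvg_cst].
have Ex : E x = 0.
  by rewrite /E big1// => i _; rewrite subrr (is_norm0 hN).
have : \forall y \near x, E y < (L1 - L) / c.
  have /(@cvgr_lt _ _ (nbhs x)) := cE; apply.
  by rewrite Ex divr_gt0// subr_gt0.
have : \forall y \near x, U y by exact: open_nbhs_nbhs.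
apply: filterS2 => y Uy Ey v.
rewrite -(subrK ('D_v g x) ('D_v g y)) (le_trans (is_normD hN _ _))//.
rewrite -(subrK L L1) mulrDl lerD//.
rewrite (derive_sum_delta _ (dg _ Uy)) (derive_sum_delta _ (dg _ Ux)) -sumrB.
rewrite (le_trans (is_norm_sum hN _))//.
rewrite (@le_trans _ _ (`|v| * E y))//.
  rewrite mulr_sumr ler_sum// => i _.
  by rewrite -scalerBr (is_normZ hN) ler_wpM2r ?(is_norm_ge0 hN) ?coord_le_norm.
rewrite (le_trans (ler_wpM2l (normr_ge0 v) (ltW Ey)))//.
rewrite mulrCA ler_wpM2l ?subr_ge0 ?(ltW LL1)//.
by rewrite ler_pdivrMr// mulrC.
Qed.

Lemma Lipschitz_neighborhood (Omega U : set 'rV[R]_d)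
    (g : 'rV[R]_d -> 'rV[R]_d) (L : R) :
  compact Omega -> convex_set (Omega : set (convex_lmodType 'rV[R]_d)) ->
  dense_interior Omega -> open U -> Omega `<=` U -> Ck_on 1 U g ->
  0 <= L < 1 ->
  (forall x y, Omega x -> Omega y -> N (g x - g y) <= L * N (x - y)) ->
  exists W L', [/\ open W, Omega `<=` W, W `<=` U, 0 <= L' < 1 &
    forall x y, W x -> W y -> N (g x - g y) <= L' * N (x - y)].
Proof.
move=> cO convO denseO oU OU g1 /andP[L0 L1] gL; have [dg Dg] := g1.
have intL x v : Omega^° x -> N ('D_v g x) <= L * N v.
  move=> Ox; apply: Lipschitz_derive_le.
    exact: dg (OU _ (interior_subset Ox)).
  by apply: filterS (Ox) => y Oy; apply: gL => //; exact: interior_subset.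
(* A violation of the bound at [x] would persist on a neighborhood of [x], which meets the interior
   by density. *)
have OL x v : Omega x -> N ('D_v g x) <= L * N v.
  move=> Ox; rewrite leNgt; apply/negP => gv.
  have : \forall y \near x, L * N v < N ('D_v g y).
    have /(is_norm_cvg hN (F := nbhs x)) := Dg v _ (OU _ Ox).
    by move/(@cvgr_gt _ _ (nbhs x)); apply.
  move=> /(denseO _ Ox)[y [Oy]] /=.
  by rewrite ltNge intL.
(* Equally spaced values L < L1' < L2 < 1: the first gap pays for leaving [Omega], the second for
   the strict bound in [mean_value_norm]. *)
pose L1' := (2 * L + 1) / 3; pose L2 := (L + 2) / 3.
pose B := U `&` [set y | forall v, N ('D_v g y) <= L1' * N v].
have OB x : Omega x -> nbhs x B.
  move=> Ox; apply: filterI.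
    by apply: open_nbhs_nbhs; split=> //; exact: OU.
  apply: (near_derive_norm_le oU g1 (OU _ Ox) (L := L)) => [|v]; last exact: OL.
  rewrite /L1'; lra.
have [e e0 eB] := compact_open_tube cO OB.
(* W is the open [e]-neighborhood of [Omega]. *)
exists [set y | exists2 x, Omega x & `|x - y| < e], L2; split.
- rewrite (_ : mkset _ = \bigcup_(x in Omega) ball x e).
    by apply: bigcup_open => x _; exact: ball_open.
  by apply/seteqP; split=> y [x Ox]; rewrite -?ball_normE => xy;
    exists x; rewrite -?ball_normE.
- by move=> x Ox; exists x => //; rewrite subrr normr0.
- by move=> y [x Ox xy]; have [] := eB _ _ Ox xy.
- rewrite /L2; apply/andP; split; lra.
move=> b a [x1 Ox1 x1b] [x0 Ox0 x0a].
have [->|ba] := eqVneq b a; first by rewrite !subrr (is_norm0 hN) mulr0.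
have Nba : 0 < N (b - a) by apply: is_norm_gt0 => //; rewrite subr_eq0.
(* Each point of the segment from [a] to [b] is within [e] of the corresponding point of the segment
   from [x0] to [x1], which lies in the convex set [Omega]. *)
have seg t : 0 <= t <= 1 -> B (a + t *: (b - a)).
  move=> t01; apply: (eB (x0 + t *: (x1 - x0))).
    exact: convex_set_line.
  have -> : x0 + t *: (x1 - x0) - (a + t *: (b - a)) =
      (1 - t) *: (x0 - a) + t *: (x1 - b).
    apply/rowP => i; rewrite !mxE; ring.
  have /andP[t0 t1] := t01.
  rewrite (le_lt_trans (ler_normD _ _))// !normrZ (ger0_norm t0).
  rewrite ger0_norm ?subr_ge0//.
  have [->|tn0] := eqVneq t 0; first by rewrite subr0 mul1r mul0r addr0.
  have tgt0 : 0 < t by rewrite lt_neqAle eq_sym tn0.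
  nra.
have := @mean_value_norm R d d N hN g a (b - a) (L2 * N (b - a)).
rewrite [a + (b - a)]addrC subrK; apply=> t /seg[Ut Bt]; first exact: dg.
rewrite (le_lt_trans (Bt _))// ltr_pM2r// /L1' /L2; lra.
Qed.

End derive_norm.

(** * Smooth inverse of a contractive perturbation of the identity *)

(** Supplies the continuity that [norm_le_is_diff] asks of a candidate derivative. *)
Lemma mulmxr_continuous (R : realType) (m n : nat) (B : 'M[R]_(m, n)) :
  continuous (fun v : 'rV[R]_m => v *m B).
Proof.
have C i : Ck_scalar 0 setT (fun v : 'rV[R]_m => (v *m B) ord0 i).
  pose f (v : 'rV[R]_m) := \sum_j v ord0 j * B j i.
  apply: (Ck_scalar_eq (k := 0) (f := f)) => [|x _|].
  - exact: openT.
  - by rewrite mxE.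
  apply: (Ck_scalar_sum (k := 0)) => [|j]; first exact: openT.
  apply: (Ck_scalarM (k := 0)) => [||]; first exact: openT.
    by move=> x _; exact: coord_continuous.
  by apply: (Ck_scalar_cst 0); exact: openT.
by move=> v; exact: ((Ck_on_coordP 0 (fun v => v *m B) openT).2 C v I).
Qed.

Section perturbation_of_identity.
Context (R : realType) (d : nat) (N : 'rV[R]_d -> R) (hN : is_norm N).
Context (W : set 'rV[R]_d) (g : 'rV[R]_d -> 'rV[R]_d) (L : R).
Context (oW : open W) (L01 : 0 <= L < 1).
Context (gL : forall x y, W x -> W y -> N (g x - g y) <= L * N (x - y)).

Let G (x : 'rV[R]_d) : 'rV[R]_d := x + g x.

Let V : set 'rV[R]_d := G @` W.

(** A chosen preimage in [W], with default value 0 outside [V]. *)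
Let H (y : 'rV[R]_d) : 'rV[R]_d := xget 0 [set x | W x /\ G x = y].

Let L0 : 0 <= L. Proof. by case/andP: L01. Qed.
Let L1 : L < 1. Proof. by case/andP: L01. Qed.

(** Triangle inequality for x - y = (G x - G y) - (g x - g y). It makes [G] injective on [W] and its
    inverse Lipschitz with constant 1 / (1 - L). *)
Lemma idD_expansion x y : W x -> W y -> (1 - L) * N (x - y) <= N (G x - G y).
Proof.
move=> Wx Wy; have := gL Wx Wy.
have := is_normD hN (G x - G y) (- (g x - g y)).
rewrite (is_normN hN) (_ : G x - G y - _ = x - y); first by lra.
by rewrite /G; apply/rowP => i; rewrite !mxE; ring.
Qed.

Lemma idD_inverseK y : V y -> W (H y) /\ G (H y) = y.
Proof.
by move=> [x Wx Gx]; apply: (@xgetPex _ 0 [set x | W x /\ G x = y]); exists x.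
Qed.

Lemma idDK x : W x -> H (G x) = x.
Proof.
move=> Wx; have [WH GH] : W (H (G x)) /\ G (H (G x)) = G x.
  by apply: idD_inverseK; exists x.
have := idD_expansion WH Wx; rewrite GH subrr (is_norm0 hN) => le0.
apply/eqP; rewrite -subr_eq0; apply/eqP/(is_norm0_eq0 hN).
have := is_norm_ge0 hN (H (G x) - x); have := L1; nra.
Qed.

(** For [y] near [G x0], a solution of G x = y is a fixed point of x |-> y - g x, a contraction on a
    small ball around [x0] inside [W]. *)
Lemma idD_open : open V.
Proof.
rewrite openE => _ [x0 Wx0 <-].
have /nbhs_ballP[e /= e0 eW] : nbhs x0 W by exact: open_nbhs_nbhs.
have [c c0 hc] := mx_norm_le_is_norm hN.
have [C C0 hC] := is_norm_le_mx_norm hN.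
pose r := e / (2 * c).
have r0 : 0 < r by rewrite divr_gt0// mulr_gt0.
have rW x : Nball N x0 r x -> W x.
  rewrite /Nball/= => xr; apply: eW; rewrite -ball_normE/= distrC.
  rewrite (le_lt_trans (hc _))// (@le_lt_trans _ _ (c * r))//.
    by rewrite ler_wpM2l// ltW.
  rewrite /r invfM mulrCA [c * _]mulrC -mulrA mulVf ?gt_eqF// mulr1; lra.
(* The displacement of [x0] is y - G x0, and this radius bounds its norm [N] by (1 - L) r. *)
rewrite /interior; apply/nbhs_ballP; exists ((1 - L) * r / C) => /=.
  by rewrite divr_gt0// mulr_gt0// subr_gt0.
move=> y; rewrite -ball_normE /= distrC ltr_pdivlMr// => yr.
have [||p pB pE] :=
  @contraction_Nball_fixpoint R d N hN (fun x => y - g x) x0 r L L01.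
- move=> a b /rW Wa /rW Wb.
  rewrite (_ : y - g a - (y - g b) = - (g a - g b)) ?(is_normN hN) ?gL//.
  by apply/rowP => i; rewrite !mxE; ring.
- rewrite -addrA -opprD -/(G x0) [g x0 + _]addrC (le_trans (hC _))//.
  by rewrite mulrC ltW.
by exists p; [exact: rW|rewrite /G -{1}pE subrK].
Qed.


Context (gC : forall k, Ck_on k W g).

Let dg x : W x -> differentiable g x. Proof. by case: (gC 1) => + _; exact. Qed.

Let J (x : 'rV[R]_d) : 'M[R]_d := 1%:M + jacobian g x.

Lemma mulmx_idD_jacobian x v : v *m J x = v + 'd g x v.
Proof. by rewrite mulmxDr mulmx1 mul_rV_lin1. Qed.

(** A kernel vector [v] satisfies v = - 'd g x v, hence N v <= L N v and v = 0. *)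
Lemma idD_jacobian_unit x : W x -> J x \in unitmx.
Proof.
move=> Wx; rewrite -row_free_unit -kermx_eq0; apply/eqP/row_matrixP => i.
rewrite row0; set v := row i _.
have : v *m J x = 0 by apply/sub_kermxP; rewrite row_sub.
rewrite mulmx_idD_jacobian => /eqP; rewrite addr_eq0 => /eqP vE.
apply: (is_norm0_eq0 hN).
have : N ('D_v g x) <= L * N v.
  apply: (Lipschitz_derive_le hN v (dg Wx)).
  by apply: filterS (open_nbhs_nbhs (conj oW Wx)) => y Wy; exact: gL.
rewrite (deriveE _ (dg Wx)) -(is_normN hN) -vE.
have := is_norm_ge0 hN v; have := L1; nra.
Qed.

(** With z = H (h + y), the increment is h = (z - x) J x + rem, where [rem] is the remainder of [g]
    at [x]. The remainder of [H] is thus - rem B, which is small relative to [h] because [H] is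
    Lipschitz at [y]. *)
Lemma idD_inverse_is_diff y : V y ->
  is_diff y H (fun v => v *m invmx (J (H y))).
Proof.
move=> Vy; have [Wx Gx] := idD_inverseK Vy.
set x := H y in Wx Gx *; set B := invmx (J x).
pose df : {linear 'rV[R]_d -> 'rV[R]_d} := mulmxr B.
have dfc : continuous df by exact: mulmxr_continuous.
apply: (@norm_le_is_diff _ _ _ H y df dfc) => e e0.
have [K K0 hK] := linear_lipschitz dfc.
have [c c0 hc] := mx_norm_le_is_norm hN.
have [C C0 hC] := is_norm_le_mx_norm hN.
have L1gt0 : 0 < 1 - L by rewrite subr_gt0 L1.
pose M := c * C / (1 - L).
have M0 : 0 < M by rewrite divr_gt0// mulr_gt0.
have HM z : V z -> `|H z - x| <= M * `|z - y|.
  move=> Vz; have [Wz Gz] := idD_inverseK Vz.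
  have := idD_expansion Wz Wx; rewrite Gz Gx => le1.
  have le2 : N (H z - x) <= C * `|z - y| / (1 - L).
    by rewrite ler_pdivlMr// mulrC (le_trans le1).
  rewrite (le_trans (hc _))// (le_trans (ler_wpM2l (ltW c0) le2))//.
  by rewrite /M !mulrA mulrAC.
(* [K] bounds multiplication by [B] and [M] is the Lipschitz constant of [H] at [y], so the three
   factors multiply to [e]. *)
have d0 : 0 < e / (K * M) by rewrite divr_gt0// mulr_gt0.
have /nbhs_ballP[r /= r0 hr] := differentiable_norm_le (dg Wx) d0.
have Vnear : \forall h \near (0 : 'rV[R]_d), V (h + y).
  have : \forall z \near y, V z by exact: open_nbhs_nbhs (conj idD_open Vy).
  by rewrite (near_shift 0 y) => /=; apply: filterS => h /=; rewrite subr0.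
have : \forall h \near (0 : 'rV[R]_d), `|h| < r / M.
  by apply: nbhs0_lt; rewrite divr_gt0.
apply: filterS2 Vnear => h Vh hr'.
have [Wz Gz] := idD_inverseK Vh; set z := H (h + y) in Wz Gz *.
have zx : `|z - x| <= M * `|h| by have := HM _ Vh; rewrite addrK.
have /hr : ball 0 r (z - x).
  rewrite -ball_normE/= sub0r normrN (le_lt_trans zx)//.
  by rewrite mulrC -ltr_pdivlMr.
rewrite subrK; set rem := g z - g x - _ => remle.
have -> : z - x - df h = - (rem *m B).
  have -> : h = (z - x) *m J x + rem.
    rewrite mulmx_idD_jacobian /rem -[LHS](addrK y) -Gz -Gx /G.
    by apply/rowP => i; rewrite !mxE; ring.
  rewrite /df /= mulmxDl /B -mulmxA mulmxV ?idD_jacobian_unit// mulmx1.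
  by rewrite opprD addrA subrr sub0r.
rewrite normrN (le_trans (hK rem))//.
rewrite (le_trans (ler_wpM2l (ltW K0) remle))//.
rewrite (le_trans (ler_wpM2l (ltW K0) (ler_wpM2l (ltW d0) zx)))//.
rewrite le_eqVlt; apply/orP; left; apply/eqP; field.
by rewrite !gt_eqF.
Qed.

Lemma Ck_scalar_idD_jacobian k i j : Ck_scalar k W (fun x => J x i j).
Proof.
have [_ /(_ (delta_mx ord0 i)) /(Ck_on_coordP _ _ oW).1 /(_ j) Cg] := gC k.+1.
apply: Ck_scalar_eq (Ck_scalarD oW (Ck_scalar_cst k (i == j)%:R oW) Cg) => //.
by move=> x Wx; rewrite !mxE deriveE//; exact: dg.
Qed.

Lemma Ck_on_idD_inverse k : Ck_on k V H.
Proof.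
have dH y : V y -> differentiable H y by move=> /idD_inverse_is_diff [].
apply/(Ck_on_coordP _ _ idD_open); elim: k => [|k IH] i.
  apply: (Ck_on_coordP 0 H idD_open).1 => y Vy.
  exact: differentiable_continuous (dH _ Vy).
split=> [y Vy|v].
  exact: (differentiable_comp (dH _ Vy) (differentiable_coord _ _ _)).
(* The derivative of the [i]-th coordinate of [H] along [v] is F composed with [H]; so [H] of order
   [k] gives a derivative of order [k]. *)
pose F x := \sum_j v ord0 j * invmx (J x) j i.
have CF : Ck_scalar k W F.
  apply: Ck_scalar_sum => // j; apply: Ck_scalarM => //.
    exact: Ck_scalar_cst.
  apply: Ck_scalar_invmx => //; first exact: idD_jacobian_unit.
  by move=> *; exact: Ck_scalar_idD_jacobian.
have CFH : Ck_scalar k V (F \o H).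
  apply: (Ck_scalar_comp idD_open _ _ IH CF) => y Vy.
    by have [] := idD_inverseK Vy.
  exact: differentiable_continuous (dH _ Vy).
apply: Ck_scalar_eq CFH; first exact: idD_open.
move=> y Vy; rewrite derive_coord; last exact: dH.
rewrite deriveE; last exact: dH.
by have [_ ->] := idD_inverse_is_diff Vy; rewrite mxE.
Qed.

End perturbation_of_identity.

Lemma idD_smooth_inverse (R : realType) (d : nat) (N : 'rV[R]_d -> R)
    (hN : is_norm N) (W : set 'rV[R]_d) (g : 'rV[R]_d -> 'rV[R]_d) (L : R) :
  smooth_on_open W g -> 0 <= L < 1 ->
  (forall x y, W x -> W y -> N (g x - g y) <= L * N (x - y)) ->
  exists H : 'rV[R]_d -> 'rV[R]_d,
    smooth_on_open [set x + g x | x in W] H /\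
    {in W, cancel (fun x => x + g x) H}.
Proof.
move=> [oW gC] L01 gL.
exists (fun y => xget 0 [set x | W x /\ x + g x = y]); split.
  split; first exact: (idD_open hN oW L01 gL).
  move=> k; exact: (Ck_on_idD_inverse hN oW L01 gL gC).
by move=> x /set_mem Wx; exact: (idDK hN L01 gL).
Qed.

(** * The diffeomorphism of Omega *)

(** The last parameter [c] at which the segment is in [A] gives a boundary point: at an interior
    point the segment would stay in [A] slightly beyond [c]. *)
Lemma segment_boundary (R : realType) (d : nat) (A : set 'rV[R]_d) x y :
  closed A -> A x -> ~ A y ->
  exists2 t : R, 0 <= t <= 1 & boundary A (x + t *: (y - x)).
Proof.
move=> clA Ax Ay; pose p (t : R) := x + t *: (y - x).
have cp : continuous p.
  move=> t; apply: cvgD; first exact: cvg_cst.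
  by apply: cvgZ; [exact: cvg_id|exact: cvg_cst].
pose S := `[0, 1] `&` p @^-1` A.
have S0 : S !=set0.
  by exists 0; rewrite /S/= in_itv/= lexx ler01 /p scale0r addr0.
have cS : compact S.
  apply: subclosed_compact (@segment_compact R 0 1) _; last by move=> t [].
  apply: closedI; first exact: itv_closed.
  by apply: closed_comp => // t _; exact: cp.
have [c /set_mem[c01 Apc] cmax] := compact_EVT_max S0 cS
  (continuous_subspaceT (fun t => cvg_id (F := nbhs t))).
move: c01; rewrite /= in_itv/= => /andP[c0 c1].
exists c; first by rewrite c0.
split; first exact: subset_closure.
move=> intc.
have cn1 : c < 1.
  rewrite lt_neqAle c1 andbT; apply/eqP => ce.
  by apply: Ay; move: Apc; rewrite /p/= ce scale1r addrC subrK.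
have /nbhs_ballP[e /= e0 he] : nbhs c (p @^-1` A) by exact: cp intc.
pose t := Num.min (c + e / 2) 1.
have ct : c < t by rewrite lt_min cn1 andbT ltrDl divr_gt0.
have : t <= c.
  apply: cmax; rewrite inE; split => /=.
    by rewrite in_itv/= ge_min lexx orbT andbT (le_trans c0)// ltW.
  apply: he; rewrite -ball_normE/= distrC gtr0_norm ?subr_gt0//.
  rewrite ltrBlDl (@le_lt_trans _ _ (c + e / 2))//.
    by rewrite ge_min lexx.
  by rewrite ltrD2l; lra.
by rewrite leNgt ct.
Qed.

(* Extending g by 0 outside A keeps its Lipschitz constant, because every
   segment leaving A crosses the boundary of A. *)
Lemma idD_bijective_on (R : realType) (d : nat) (N : 'rV[R]_d -> R)
    (hN : is_norm N) (A : set 'rV[R]_d) (g : 'rV[R]_d -> 'rV[R]_d) (L : R) :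
  closed A -> 0 <= L < 1 ->
  (forall x y, A x -> A y -> N (g x - g y) <= L * N (x - y)) ->
  (forall x, boundary A x -> g x = 0) ->
  (forall x, A x -> A (x + g x)) /\
  (forall y, A y -> exists2 x, A x & x + g x = y).
Proof.
move=> clA L01 gL g0; have /andP[L0 L1] := L01.
pose h x := if x \in A then g x else 0.
have hLio x y : A x -> ~ A y -> N (g x) <= L * N (x - y).
  move=> Ax Ay; have [t t01 bz] := segment_boundary clA Ax Ay.
  set z := x + _ in bz.
  have Az : A z by move: bz => []; rewrite -(closure_id A).1.
  have := gL _ _ Ax Az; rewrite (g0 _ bz) subr0 => /le_trans; apply.
  rewrite ler_wpM2l// /z opprD addrA subrr sub0r -scalerN opprB (is_normZ hN).
  have /andP[t0 t1] := t01.
  by rewrite ger0_norm// ler_piMl// is_norm_ge0.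
have hL x y : N (h x - h y) <= L * N (x - y).
  rewrite /h; have [/set_mem Ax|/negP Ax] := boolP (x \in A);
    have [/set_mem Ay|/negP Ay] := boolP (y \in A).
  - exact: gL.
  - by rewrite subr0; apply: hLio => // /mem_set.
  - rewrite sub0r (is_normN hN) (is_norm_distrC hN).
    by apply: hLio => // /mem_set.
  - by rewrite subrr (is_norm0 hN) mulr_ge0// is_norm_ge0.
split=> [x Ax|y Ay].
  (* If y = x + g x left [A], then h y = 0 and N (x - y) = N (h x - h y) <= L N (x - y), forcing y =
     x. *)
  apply: contrapT => Ay; set y := x + g x in Ay.
  have hx : h x = g x by rewrite /h mem_set.
  have hy : h y = 0 by rewrite /h memNset.
  have := hL x y; rewrite hx hy subr0.
  have -> : g x = - (x - y) by rewrite /y opprB addrAC subrr add0r.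
  rewrite (is_normN hN) => le1.
  have xy : x - y = 0.
    apply: (is_norm0_eq0 hN); have := is_norm_ge0 hN (x - y); nra.
  by apply: Ay; move/eqP : xy; rewrite subr_eq0 => /eqP <-.
(* A fixed point [p] of x |-> y - h x solves p + h p = y; outside [A] it would equal [y], which is
   in [A]. *)
have [|p pE] := @contraction_fixpoint R d N hN (fun x => y - h x) L L01.
  move=> a b.
  rewrite (_ : y - h a - (y - h b) = - (h a - h b)) ?(is_normN hN)//.
  by apply/rowP => i; rewrite !mxE; ring.
move: pE; rewrite /h; have [/set_mem Ap|/negP Ap] := boolP (p \in A).
  by move=> /eqP; rewrite subr_eq => /eqP ->; exists p.
by rewrite subr0 => yp; exfalso; apply: Ap; rewrite -yp mem_set.
Qed.

Lemma Ck_scalar_coord (R : realType) (m k : nat) (U : set 'rV[R]_m) i :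
  open U -> Ck_scalar k U (fun x => x ord0 i).
Proof.
move=> oU; case: k => [|k]; first by move=> x _; exact: coord_continuous.
split=> [x _|v]; first exact: differentiable_coord.
apply: Ck_scalar_eq (Ck_scalar_cst k (v ord0 i) oU) => // x _.
by rewrite (derive_coord (f := id))// derive_id.
Qed.

(** The factor [c] covers both uses: 1 for id + f and -1 for phi - id. *)
Lemma smooth_on_openDZ (R : realType) (m : nat) (U : set 'rV[R]_m)
    (g : 'rV[R]_m -> 'rV[R]_m) (c : R) :
  smooth_on_open U g -> smooth_on_open U (fun x => c *: x + g x).
Proof.
move=> [oU Cg]; split=> // k; apply/(Ck_on_coordP _ _ oU) => i.
have Ci := Ck_scalarM oU (Ck_scalar_cst k c oU) (Ck_scalar_coord k i oU).
apply: Ck_scalar_eq (Ck_scalarD oU Ci ((Ck_on_coordP k g oU).1 (Cg k) i)) => //.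
by move=> x _; rewrite !mxE.
Qed.

Lemma kappa_Cinf_bd (R : realType) (d : nat) (Omega : set 'rV[R]_d)
    (phi : Omega -> Omega) : Diff_bd phi -> Cinf_bd (kappa phi).
Proof.
move=> [[[U [g [OU sg gphi]]] _] bphi]; split=> [|x bx]; last first.
  by rewrite /kappa bphi// subrr.
exists U, (fun x => (- 1) *: x + g x).
split=> //; first exact: smooth_on_openDZ.
by move=> x; rewrite gphi scaleN1r addrC.
Qed.

Lemma U1_Diff_bd (R : realType) (d : nat) (Omega : set 'rV[R]_d)
    (N : 'rV[R]_d -> R) (f : Omega -> 'rV[R]_d) : is_norm N ->
  compact Omega -> convex_set (Omega : set (convex_lmodType 'rV[R]_d)) ->
  dense_interior Omega -> U1 N f ->
  exists2 phi : Omega -> Omega, Diff_bd phi &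
    forall x : Omega, val (phi x) = val x + f x.
Proof.
move=> hN cO convO dO [[[U [g [OU [oU Cg] gf]]] bf]].
(* An infimum below 1 provides an actual Lipschitz constant L < 1. *)
move=> /ereal_inf_lt[_ [L [L0 fL] <-]].
rewrite lte_fin => L1; have L01 : 0 <= L < 1 by rewrite L0.
have gE x (Ox : Omega x) : g x = f (SigSub (mem_set Ox)) by rewrite -gf.
have gL x y : Omega x -> Omega y -> N (g x - g y) <= L * N (x - y).
  by move=> Ox Oy; rewrite (gE _ Ox) (gE _ Oy); exact: fL.
have clO : closed Omega by apply: compact_closed => //; exact: norm_hausdorff.
have g0 x : boundary Omega x -> g x = 0.
  move=> bx; have Ox : Omega x by move: bx => []; rewrite -(closure_id Omega).1.
  by rewrite (gE _ Ox) bf.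
have [GO GOs] := idD_bijective_on hN clO L01 gL g0.
have [W [L' [oW OW WU L'01 gL']]] :=
  Lipschitz_neighborhood hN cO convO dO oU OU (Cg 1) L01 gL.
have sgW : smooth_on_open W g.
  split=> // k; apply/(Ck_on_coordP _ _ oW) => i.
  apply: Ck_scalar_subset WU _; exact: (Ck_on_coordP k g oU).1.
have [H [sH HK]] := idD_smooth_inverse hN sgW L'01 gL'.
(* Each [y] in [Omega] is x + g x with [x] in [Omega], and [H] recovers this [x]; so [H] preserves
   [Omega]. *)
have HO y : Omega y -> Omega (H y) /\ H y + g (H y) = y.
  by move=> /GOs[x Ox <-]; rewrite HK//; apply/mem_set/OW.
have inO (x : Omega) : Omega (val x) by exact: set_valP.
pose phi (x : Omega) : Omega := SigSub (mem_set (GO _ (inO x))).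
pose psi (y : Omega) : Omega := SigSub (mem_set (HO _ (inO y)).1).
exists phi => [|x]; last by rewrite /= gf.
split; last by move=> x bx; apply: val_inj => /=; rewrite (g0 _ bx) addr0.
split.
  exists W, (fun x => 1 *: x + g x); split=> //; first exact: smooth_on_openDZ.
  by move=> x; rewrite scale1r.
exists psi; split=> [x|y|].
- by apply: val_inj => /=; rewrite HK//; apply/mem_set/OW/inO.
- by apply: val_inj => /=; have [] := HO _ (inO y).
(* The image of [W] is open and contains [Omega], the image of [Omega] itself, so [H] is a smooth
   extension of [psi]. *)
- exists [set x + g x | x in W], H; split=> // y Oy.
  by have [x Ox <-] := GOs _ Oy; exists x => //; exact: OW.
Qed.

Theorem lemma3p1 (R : realType) (d : nat) (Omega : set 'rV[R]_d)
    (N : 'rV[R]_d -> R) (hN : is_norm N)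
    (hcompact : compact Omega)
    (hconvex : convex_set (Omega : set (convex_lmodType 'rV[R]_d)))
    (hdense : dense_interior Omega) :
  [/\ forall f : Omega -> 'rV[R]_d, U1 N f ->
        exists2 phi : Omega -> Omega, Diff_bd phi &
          forall x : Omega, val (phi x) = val x + f x,
      forall phi : Omega -> Omega, Diff_bd phi -> Cinf_bd (kappa phi),
      @U1 R d N Omega `<=` @kappa R d Omega @` @Diff_bd R d Omega &
      forall f : Omega -> 'rV[R]_d, U1 N f ->
        exists2 phi : Omega -> Omega,
          @Diff_bd R d Omega `&` @kappa R d Omega @^-1` [set f] = [set phi] &
          forall x : Omega, val (phi x) = val x + f x].
Proof.
have main (f : Omega -> 'rV[R]_d) : U1 N f ->
    exists2 phi : Omega -> Omega, Diff_bd phi &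
      forall x : Omega, val (phi x) = val x + f x.
  exact: U1_Diff_bd.
have kappaE (f : Omega -> 'rV[R]_d) (phi : Omega -> Omega) :
    (forall x, val (phi x) = val x + f x) -> kappa phi = f.
  by move=> phiE; apply/funext => x; rewrite /kappa phiE addrC addKr.
split=> // [phi|f /main[phi Dphi phiE]|f /main[phi Dphi phiE]].
- exact: kappa_Cinf_bd.
- by exists phi => //; exact: kappaE.
(* The fibre of [kappa] over [f] is a single point, because kappa chi = f determines every value of
   [chi]. *)
- exists phi => //; apply/seteqP; split=> [chi [Dchi /= chif]|_ ->]; last first.
    by split=> //; exact: kappaE.
  apply/funext => x; apply: val_inj; rewrite phiE -chif /kappa.
  by rewrite addrC subrK.
Qed.
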